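(* Let $a,d\in\mathbb{C}$ with $2a\notin\mathbb{Z}_0^-$ and $d\notin\mathbb{Z}_0^-$. Then for every $x\in\mathbb{C}$, $$e^{-x/2}\,{}_2F_2\!\left(\begin{matrix}a,\ d+1\\ 2a,\ d\end{matrix};x\right)={}_1F_2\!\left(\begin{matrix}1+\tfrac d2\\ a+\tfrac12,\ \tfrac d2\end{matrix};\frac{x^2}{16}\right)+\frac{x}{2d}\,{}_0F_1\!\left(\begin{matrix}-\\ a+\tfrac12\end{matrix};\frac{x^2}{16}\right).$$
   Context: $\mathbb{Z}_0^-=\{0,-1,-2,\dots\}$ and $\mathbb{N}_0=\{0,1,2,\dots\}$. For $\alpha\in\mathbb{C}$ and $n\in\mathbb{N}_0$, the Pochhammer symbol is $(\alpha)_0=1$, $(\alpha)_n=\alpha(\alpha+1)\cdots(\alpha+n-1)$ for $n\ge1$. For $\alpha_j\in\mathbb{C}$, $\beta_j\in\mathbb{C}\setminus\mathbb{Z}_0^-$ the generalized hypergeometric function is $${}_pF_q\!\left(\begin{matrix}\alpha_1,\dots,\alpha_p\\ \beta_1,\dots,\beta_q\end{matrix};z\right)=\sum_{n=0}^\infty\frac{(\alpha_1)_n\cdots(\alpha_p)_n}{(\beta_1)_n\cdots(\beta_q)_n}\frac{z^n}{n!};$$ an empty list of parameters (written $-$) contributes the empty product $1$. For $p\le q$ the series converges for all $z\in\mathbb{C}$. *)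

(* Defs.v *)
From Stdlib Require Import Reals List Factorial.
From Coquelicot Require Import Coquelicot.
Import ListNotations.
Open Scope C_scope.

Definition nonpos_int (z : C) : Prop := exists n : nat, z = - RtoC (INR n).

Fixpoint pochhammer (alpha : C) (n : nat) : C :=
  match n with
  | O => 1
  | S m => pochhammer alpha m * (alpha + RtoC (INR m))
  end.

Definition pochhammer_prod (l : list C) (n : nat) : C :=
  fold_right Cmult (RtoC 1) (map (fun alpha => pochhammer alpha n) l).

(* Coquelicot's [Series] is real-valued, so it is taken componentwise; like
   [Series], this is only meaningful for convergent series, see
   [is_series_CSeries]. *)
Definition CSeries (u : nat -> C) : C :=
  (Series (fun n => Re (u n)), Series (fun n => Im (u n))).

Definition hypergeometric (alphas betas : list C) (z : C) : C :=
  CSeries (fun n =>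
    pochhammer_prod alphas n / pochhammer_prod betas n
    * (z ^ n / RtoC (INR (fact n)))).

Definition Cexp (z : C) : C :=
  RtoC (exp (Re z)) * (cos (Im z), sin (Im z)).

Lemma is_series_CSeries (u : nat -> C) (l : C) :
  is_series u l -> CSeries u = l.
Proof.
intros H.
assert (Hre : forall n, Re (sum_n u n) = sum_n (fun k => Re (u k)) n).
{ induction n as [|n IH]; [now rewrite !sum_O|].
  now rewrite !sum_Sn, <- IH. }
assert (Him : forall n, Im (sum_n u n) = sum_n (fun k => Im (u k)) n).
{ induction n as [|n IH]; [now rewrite !sum_O|].
  now rewrite !sum_Sn, <- IH. }
destruct l as [lr li]; unfold CSeries; f_equal; apply is_series_unique;
  apply filterlim_locally; intros eps;
  assert (He := proj1 (filterlim_locally (U := C_UniformSpace) _ _) H eps);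
  revert He; apply filter_imp; intros n [H1 H2].
- now rewrite <- Hre.
- now rewrite <- Him.
Qed.

(* Main.v *)
Require Import Defs.
From Stdlib Require Import Reals List Lra Lia Factorial.
From Coquelicot Require Import Coquelicot.
Import ListNotations.
Open Scope C_scope.

(** Write [e_z] for the coefficient sequence [z^n/n!] of the exponential and
    [f] for the terms of the Kummer series [1F1(a; 2a; x)].  Since
    [(d+1)_k / (d)_k = 1 + k/d], the left-hand series has terms
    [f_k + k f_k / d], so the Cauchy product with [e_(-x/2)] has terms
    [s_n + t_n / d], where [s] is the Cauchy product of [f] with [e_(-x/2)]
    and [t] that of [k f_k] with [e_(-x/2)] ([kummer_coef] and
    [kummer_moment]).

    The Euler operator [theta = x d/dx] multiplies the n-th term by [n] and is
    a derivation for the Cauchy product, and [theta e_z] is the shift of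
    [z e_z].  This gives [t_(n+1) = (n+1) s_(n+1) + (x/2) s_n], so everything
    is expressed by [s].  The hypergeometric equation for [1F1(a; 2a)],
    transported through the product with the exponential, becomes
    [(n+2) (2a+n+1) s_(n+2) = (x^2/4) s_n] ([kummer_coef_SS]): the choice of
    [2a] as lower parameter and of [-1/2] as exponential rate is what cancels
    the one-step term.  As [s_1 = 0], the odd [s] vanish and the even ones are
    the terms of [0F1(; a+1/2; x^2/16)], which is Kummer's second theorem.

    Hence the terms of the product of even index [2m] are
    [(1 + 2m/d) s_(2m)], that is, the terms of [1F2], because
    [1 + 2m/d] is the contiguous factor for the parameter [d/2]; and those of
    odd index [2m+1] are [x/(2d) s_(2m)] ([cauchy_coef_even],
    [cauchy_coef_odd]).  Analysis enters through absolute convergence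
    ([hyp_term_abs_summable]), the product of absolutely convergent series
    ([is_series_cauchy_product]), the summation of even and odd terms apart
    ([is_series_even_odd]) and the exponential series
    ([hypergeometric_exp]). *)

(** * Arithmetic of natural numbers in C *)

Lemma RtoC_INR_S (n : nat) : RtoC (INR (S n)) = RtoC (INR n) + 1.
Proof. now rewrite S_INR, RtoC_plus. Qed.

Lemma INR_S_neq_0 (n : nat) : RtoC (INR n) + 1 <> 0.
Proof.
rewrite <- RtoC_INR_S; intros H; apply RtoC_inj in H; now apply (not_0_INR (S n)).
Qed.

Lemma Cmult_cancel_l (c u v : C) : c <> 0 -> c * u = c * v -> u = v.
Proof.
intros Hc E.
transitivity (/ c * (c * u)); [field; exact Hc|].
rewrite E; field; exact Hc.
Qed.

Lemma INR_fact_neq_0_C (n : nat) : RtoC (INR (fact n)) <> 0.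
Proof. intros H; apply RtoC_inj in H; now apply (INR_fact_neq_0 n). Qed.

Lemma INR_fact_S_C (n : nat) :
  RtoC (INR (fact (S n))) = (RtoC (INR n) + 1) * RtoC (INR (fact n)).
Proof. now rewrite fact_simpl, mult_INR, RtoC_mult, RtoC_INR_S. Qed.

(** * Series of complex numbers *)

Lemma Re_sum_n (u : nat -> C) n : Re (sum_n u n) = sum_n (fun k => Re (u k)) n.
Proof.
induction n as [|n IH]; [now rewrite !sum_O|]; now rewrite !sum_Sn, <- IH.
Qed.

Lemma Im_sum_n (u : nat -> C) n : Im (sum_n u n) = sum_n (fun k => Im (u k)) n.
Proof.
induction n as [|n IH]; [now rewrite !sum_O|]; now rewrite !sum_Sn, <- IH.
Qed.

Lemma is_series_components (u : nat -> C) (lr li : R) :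
  is_series (fun n => Re (u n)) lr -> is_series (fun n => Im (u n)) li ->
  is_series u ((lr, li) : C).
Proof.
intros Hr Hi.
apply (proj2 (filterlim_locally (U := C_UniformSpace) _ _)); intros eps.
assert (Er := proj1 (filterlim_locally (U := R_UniformSpace) _ _) Hr eps).
assert (Ei := proj1 (filterlim_locally (U := R_UniformSpace) _ _) Hi eps).
generalize (filter_and _ _ Er Ei); apply filter_imp; intros n [H1 H2].
split; [rewrite <- Re_sum_n in H1; exact H1 | rewrite <- Im_sum_n in H2; exact H2].
Qed.

(** Absolute convergence is what a ratio bound gives and what both the sum of
    a complex series and the product of two series are derived from. *)
Definition abs_summable (u : nat -> C) : Prop := ex_series (fun n => Cmod (u n)).

Lemma abs_summable_Re (u : nat -> C) :
  abs_summable u -> ex_series (fun n => Rabs (Re (u n))).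
Proof.
apply (ex_series_le (V := R_CompleteNormedModule)); intros n.
change (Rabs (Rabs (Re (u n))) <= Cmod (u n))%R.
rewrite Rabs_Rabsolu; apply re_le_Cmod.
Qed.

Lemma abs_summable_Im (u : nat -> C) :
  abs_summable u -> ex_series (fun n => Rabs (Im (u n))).
Proof.
apply (ex_series_le (V := R_CompleteNormedModule)); intros n.
change (Rabs (Rabs (Im (u n))) <= Cmod (u n))%R.
rewrite Rabs_Rabsolu.
apply Rle_trans with (2 := Rmax_Cmod (u n)), Rmax_r.
Qed.

Lemma abs_summable_is_series (u : nat -> C) :
  abs_summable u -> is_series u (CSeries u).
Proof.
intros Hu; apply is_series_components; apply Series_correct, ex_series_Rabs;
  [now apply abs_summable_Re | now apply abs_summable_Im].
Qed.

(** The partial sums of even and of odd index both tend to [l0 + l1], and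
    together these exhaust all partial sums. *)
Lemma is_series_even_odd (u : nat -> C) (l0 l1 : C) :
  is_series (fun m => u (2 * m)%nat) l0 ->
  is_series (fun m => u (2 * m + 1)%nat) l1 ->
  is_series u (l0 + l1).
Proof.
intros H0 H1.
assert (E : forall m, sum_n u (2 * m + 1) =
  sum_n (fun k => u (2 * k)%nat) m + sum_n (fun k => u (2 * k + 1)%nat) m).
{ induction m as [|m IH].
  - change (2 * 0 + 1)%nat with 1%nat.
    now rewrite sum_Sn, !sum_O.
  - replace (2 * S m + 1)%nat with (S (S (2 * m + 1))) by lia.
    rewrite !sum_Sn, IH.
    replace (S (2 * m + 1)) with (2 * S m)%nat by lia.
    replace (S (2 * S m)) with (2 * S m + 1)%nat by lia.
    unfold plus; simpl; ring. }
assert (L1 : filterlim (fun m => sum_n u (2 * m + 1)) eventually (locally (l0 + l1))).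
{ apply filterlim_ext with
    (f := fun m => plus (sum_n (fun k => u (2 * k)%nat) m)
                        (sum_n (fun k => u (2 * k + 1)%nat) m)).
  - intros m; now rewrite E.
  - eapply filterlim_comp_2; [exact H0 | exact H1 | exact (filterlim_plus l0 l1)]. }
(* [2 * S m], not [2 * m]: the odd part of the sum up to [2 * S m] ends at
   index [2 * m + 1], the [m]-th odd one; with [2 * m] it would be a
   predecessor. *)
assert (L0 : filterlim (fun m => sum_n u (2 * S m)) eventually (locally (l0 + l1))).
{ apply filterlim_ext with
    (f := fun m => plus (sum_n (fun k => u (2 * k)%nat) (S m))
                        (sum_n (fun k => u (2 * k + 1)%nat) m)).
  - intros m.
    replace (2 * S m)%nat with (S (2 * m + 1)) by lia.
    rewrite (sum_Sn u), E, sum_Sn.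
    replace (2 * S m)%nat with (S (2 * m + 1)) by lia.
    unfold plus; simpl; ring.
  - assert (H0' : filterlim (fun m => sum_n (fun k => u (2 * k)%nat) (S m))
                    eventually (locally l0)).
    { eapply filterlim_comp; [|exact H0].
      intros P [N HN]; exists N; intros n Hn; apply HN; lia. }
    eapply filterlim_comp_2; [exact H0' | exact H1 | exact (filterlim_plus l0 l1)]. }
intros P HP; destruct (L0 P HP) as [N0 HN0], (L1 P HP) as [N1 HN1].
exists (2 * N0 + 2 * N1 + 2)%nat; intros n Hn.
destruct (Nat.Even_or_Odd n) as [[m Hm] | [m Hm]].
- destruct m as [|m]; [lia|]; rewrite Hm; apply HN0; lia.
- rewrite Hm; apply HN1; lia.
Qed.

(** * Cauchy products *)

Definition cauchy_product (u v : nat -> C) (n : nat) : C :=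
  sum_n (fun k => u k * v (n - k)%nat) n.

Lemma is_series_mult_Reals (a b : nat -> R) :
  ex_series (fun n => Rabs (a n)) -> ex_series (fun n => Rabs (b n)) ->
  is_series (fun n => sum_n (fun k => (a k * b (n - k)%nat)%R) n)
    (Series a * Series b)%R.
Proof.
intros Ha Hb.
eapply is_series_ext; cycle 1.
- apply is_series_mult; [| |exact Ha|exact Hb];
    apply Series_correct, ex_series_Rabs; assumption.
- intros n; symmetry; apply sum_n_Reals.
Qed.

(** The real and imaginary parts of a product are combinations of four real
    Cauchy products, each an instance of the product theorem for real series. *)
Lemma is_series_cauchy_product (u v : nat -> C) :
  abs_summable u -> abs_summable v ->
  is_series (cauchy_product u v) (CSeries u * CSeries v).
Proof.
intros Hu Hv.
assert (Hur := abs_summable_Re u Hu); assert (Hui := abs_summable_Im u Hu).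
assert (Hvr := abs_summable_Re v Hv); assert (Hvi := abs_summable_Im v Hv).
apply is_series_components.
- eapply is_series_ext; cycle 1.
  + exact (is_series_minus _ _ _ _ (is_series_mult_Reals _ _ Hur Hvr)
             (is_series_mult_Reals _ _ Hui Hvi)).
  + intros n; unfold cauchy_product; rewrite Re_sum_n, !sum_n_Reals.
    exact (eq_sym (minus_sum _ _ n)).
- eapply is_series_ext; cycle 1.
  + exact (is_series_plus _ _ _ _ (is_series_mult_Reals _ _ Hur Hvi)
             (is_series_mult_Reals _ _ Hui Hvr)).
  + intros n; unfold cauchy_product; rewrite Im_sum_n.
    rewrite <- sum_n_plus; apply sum_n_ext; intros k; reflexivity.
Qed.

(** Multiplication by [n] is the Euler operator [x d/dx] on coefficients; it
    obeys the Leibniz rule since [n = k + (n - k)]. *)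
Lemma cauchy_product_euler (u v : nat -> C) (n : nat) :
  RtoC (INR n) * cauchy_product u v n =
  cauchy_product (fun k => RtoC (INR k) * u k) v n
  + cauchy_product u (fun k => RtoC (INR k) * v k) n.
Proof.
unfold cauchy_product.
rewrite <- (sum_n_mult_l (K := C_Ring)).
change Cplus with (@plus C_AbelianGroup).
rewrite <- sum_n_plus.
apply sum_n_ext_loc; intros k Hk.
rewrite minus_INR, RtoC_minus by exact Hk.
unfold plus, mult; simpl; ring.
Qed.

(** The generating series of [u] is [X] times that of [v]; the factor [X] can
    be taken out of the product. *)
Lemma cauchy_product_shift_l (u v w : nat -> C) (n : nat) :
  u 0%nat = 0 -> (forall k, u (S k) = v k) ->
  cauchy_product u w (S n) = cauchy_product v w n.
Proof.
intros H0 HS; unfold cauchy_product, sum_n.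
rewrite sum_Sn_m by lia.
rewrite <- sum_n_m_S, H0.
rewrite (sum_n_m_ext _ (fun k => v k * w (n - k)%nat)).
- unfold plus; simpl; ring.
- intros k; rewrite HS; reflexivity.
Qed.

Lemma cauchy_product_shift_r (u v w : nat -> C) (n : nat) :
  u 0%nat = 0 -> (forall k, u (S k) = v k) ->
  cauchy_product w u (S n) = cauchy_product w v n.
Proof.
intros H0 HS; unfold cauchy_product.
rewrite sum_Sn, Nat.sub_diag, H0.
rewrite (sum_n_ext_loc _ (fun k => w k * v (n - k)%nat)).
- unfold plus; simpl; ring.
- intros k Hk; rewrite Nat.sub_succ_l, HS by exact Hk; reflexivity.
Qed.

Lemma cauchy_product_linear_l (c1 c2 : C) (u1 u2 v : nat -> C) (n : nat) :
  cauchy_product (fun k => c1 * u1 k + c2 * u2 k) v n =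
  c1 * cauchy_product u1 v n + c2 * cauchy_product u2 v n.
Proof.
unfold cauchy_product.
rewrite <- !(sum_n_mult_l (K := C_Ring)).
change Cplus with (@plus C_AbelianGroup).
rewrite <- sum_n_plus.
apply sum_n_ext; intros k.
unfold plus, mult; simpl; ring.
Qed.

Lemma cauchy_product_scal_l (c : C) (u v : nat -> C) (n : nat) :
  cauchy_product (fun k => c * u k) v n = c * cauchy_product u v n.
Proof.
unfold cauchy_product.
rewrite <- !(sum_n_mult_l (K := C_Ring)).
apply sum_n_ext; intros k.
unfold mult; simpl; ring.
Qed.

Lemma cauchy_product_scal_r (c : C) (u v : nat -> C) (n : nat) :
  cauchy_product u (fun k => c * v k) n = c * cauchy_product u v n.
Proof.
unfold cauchy_product.
rewrite <- !(sum_n_mult_l (K := C_Ring)).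
apply sum_n_ext; intros k.
unfold mult; simpl; ring.
Qed.

(** * Convergence of the hypergeometric series *)

(** From the point where [n] exceeds [2 M], each term is at most half of the
    one before it, and a geometric series dominates. *)
Lemma abs_summable_of_ratio (u : nat -> C) (M : R) (N : nat) :
  (forall n, (N <= n)%nat -> (INR (S n) * Cmod (u (S n)) <= M * Cmod (u n))%R) ->
  abs_summable u.
Proof.
intros H.
destruct (INR_unbounded (2 * M)) as [N' HN'].
assert (Hhalf : forall n, (N + N' <= n)%nat ->
  (Cmod (u (S n)) <= / 2 * Cmod (u n))%R).
{ intros n Hn.
  assert (H1 := H n ltac:(lia)).
  assert (H2 : (INR N' <= INR (S n))%R) by (apply le_INR; lia).
  assert (H3 := Cmod_ge_0 (u n)); assert (H4 := Cmod_ge_0 (u (S n))).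
  assert (H5 : (0 < INR (S n))%R) by (apply lt_0_INR; lia).
  apply Rmult_le_reg_l with (1 := H5); nra. }
apply (ex_series_incr_n (V := R_NormedModule) _ (N + N')%nat).
apply (ex_series_le (V := R_CompleteNormedModule)) with
  (b := fun k => (Cmod (u (N + N')%nat) * (/ 2) ^ k)%R).
- intros k.
  change (Rabs (Cmod (u (N + N' + k)%nat)) <= Cmod (u (N + N')%nat) * (/ 2) ^ k)%R.
  rewrite Rabs_pos_eq by apply Cmod_ge_0.
  induction k as [|k IH].
  + rewrite Nat.add_0_r; simpl; lra.
  + rewrite Nat.add_succ_r; simpl.
    assert (H1 := Hhalf (N + N' + k)%nat ltac:(lia)); lra.
- apply (ex_series_scal_l (V := R_NormedModule)), ex_series_geom.
  rewrite Rabs_pos_eq; lra.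
Qed.

(** The ratio of consecutive values of [pochhammer_prod]. *)
Definition shifted_prod (l : list C) (n : nat) : C :=
  fold_right Cmult (RtoC 1) (map (fun alpha => alpha + RtoC (INR n)) l).

Lemma pochhammer_prod_S (l : list C) (n : nat) :
  pochhammer_prod l (S n) = pochhammer_prod l n * shifted_prod l n.
Proof.
unfold pochhammer_prod, shifted_prod.
induction l as [|c l IH]; simpl in *; [ring|]; rewrite IH; ring.
Qed.

Lemma pochhammer_prod_0 (l : list C) : pochhammer_prod l 0 = 1.
Proof.
unfold pochhammer_prod; induction l as [|c l IH]; simpl in *; [easy|].
rewrite IH; ring.
Qed.

Lemma add_INR_neq_0 (c : C) (n : nat) : ~ nonpos_int c -> c + RtoC (INR n) <> 0.
Proof.
intros Hc H; apply Hc; exists n.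
replace c with (c + RtoC (INR n) - RtoC (INR n)) by ring; rewrite H; ring.
Qed.

Lemma neq_0_of_not_nonpos_int (c : C) : ~ nonpos_int c -> c <> 0.
Proof. intros Hc; rewrite <- (Cplus_0_r c); exact (add_INR_neq_0 c 0 Hc). Qed.

Definition admissible (betas : list C) : Prop :=
  List.Forall (fun b => ~ nonpos_int b) betas.

Lemma shifted_prod_neq_0 (betas : list C) (n : nat) :
  admissible betas -> shifted_prod betas n <> 0.
Proof.
unfold shifted_prod; induction 1 as [|b l Hb _ IH]; simpl.
- exact C1_nz.
- apply Cmult_neq_0; [now apply add_INR_neq_0 | exact IH].
Qed.

Lemma pochhammer_prod_neq_0 (betas : list C) (n : nat) :
  admissible betas -> pochhammer_prod betas n <> 0.
Proof.
intros Hb; induction n as [|n IH].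
- rewrite pochhammer_prod_0; exact C1_nz.
- rewrite pochhammer_prod_S; apply Cmult_neq_0; [exact IH|].
  now apply shifted_prod_neq_0.
Qed.

(** This bound and the next one show that the product of [p] shifted
    parameters has the exact order [n^p]. *)
Lemma shifted_prod_upper (l : list C) :
  exists A : R, (0 <= A)%R /\
    forall n, (Cmod (shifted_prod l n) <= A * INR (S n) ^ length l)%R.
Proof.
unfold shifted_prod; induction l as [|c l [A [HA IH]]]; simpl length; simpl.
- exists 1%R; split; [lra|]; intros n; rewrite Cmod_1; lra.
- exists ((Cmod c + 1) * A)%R.
  assert (Hc := Cmod_ge_0 c).
  split; [nra|]; intros n.
  rewrite Cmod_mult.
  assert (H1 : (Cmod (c + RtoC (INR n)) <= (Cmod c + 1) * INR (S n))%R).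
  { apply Rle_trans with (1 := Cmod_triangle _ _).
    assert (H0 := pos_INR n).
    rewrite Cmod_R, Rabs_pos_eq, S_INR by exact H0; nra. }
  apply Rle_trans with (((Cmod c + 1) * INR (S n)) * (A * INR (S n) ^ length l))%R.
  + apply Rmult_le_compat; [apply Cmod_ge_0 | apply Cmod_ge_0 | exact H1 | apply IH].
  + apply Req_le; change (match n with O => 1 | S _ => INR n + 1 end)%R with (INR (S n)).
    ring.
Qed.

Lemma shifted_prod_lower (l : list C) :
  exists N : nat, forall n, (N <= n)%nat ->
    (INR (S n) ^ length l <= 2 ^ length l * Cmod (shifted_prod l n))%R.
Proof.
unfold shifted_prod; induction l as [|c l [N IH]]; simpl length; simpl fold_right.
- exists 0%nat; intros n _; rewrite Cmod_1; simpl; lra.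
- (* once [n] exceeds [2 |c| + 1], [|c + n| >= n - |c| >= (n + 1) / 2] *)
  destruct (INR_unbounded (2 * Cmod c + 1)) as [N' HN'].
  exists (N + N')%nat; intros n Hn; rewrite Cmod_mult, <- !tech_pow_Rmult.
  assert (H1 : (INR (S n) <= 2 * Cmod (c + RtoC (INR n)))%R).
  { assert (H2 : (INR N' <= INR n)%R) by (apply le_INR; lia).
    assert (H3 := Cmod_triangle (c + RtoC (INR n)) (- c)).
    replace (c + RtoC (INR n) + - c) with (RtoC (INR n)) in H3 by ring.
    rewrite Cmod_opp, Cmod_R, Rabs_pos_eq in H3 by apply pos_INR.
    rewrite S_INR; lra. }
  assert (H2 := IH n ltac:(lia)).
  apply Rle_trans with (2 * Cmod (c + RtoC (INR n)) *
    (2 ^ length l * Cmod (shifted_prod l n)))%R.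
  + apply Rmult_le_compat; [apply pos_INR | apply pow_le, pos_INR | exact H1 | exact H2].
  + apply Req_le; unfold shifted_prod; ring.
Qed.

Definition hyp_term (alphas betas : list C) (z : C) (n : nat) : C :=
  pochhammer_prod alphas n / pochhammer_prod betas n
  * (z ^ n / RtoC (INR (fact n))).

Lemma hyp_term_0 (alphas betas : list C) (z : C) : hyp_term alphas betas z 0 = 1.
Proof.
unfold hyp_term; rewrite !pochhammer_prod_0; simpl; field.
Qed.

(** The hypergeometric recurrence, cleared of denominators. *)
Lemma hyp_term_S (alphas betas : list C) (z : C) (n : nat) :
  admissible betas ->
  (RtoC (INR n) + 1) * shifted_prod betas n * hyp_term alphas betas z (S n)
  = z * shifted_prod alphas n * hyp_term alphas betas z n.
Proof.
intros Hb; unfold hyp_term; rewrite !pochhammer_prod_S, INR_fact_S_C, Cpow_S.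
assert (H1 := pochhammer_prod_neq_0 betas n Hb).
assert (H2 := shifted_prod_neq_0 betas n Hb).
assert (H3 := INR_S_neq_0 n); assert (H4 := INR_fact_neq_0_C n).
field; auto.
Qed.

(** The ratio of consecutive terms has order [n^(p-q-1)], hence [O(1/n)] when
    [p <= q]. *)
Lemma hyp_term_abs_summable (alphas betas : list C) (z : C) :
  (length alphas <= length betas)%nat -> admissible betas ->
  abs_summable (hyp_term alphas betas z).
Proof.
intros Hlen Hb.
destruct (shifted_prod_upper alphas) as [A [HA Hup]].
destruct (shifted_prod_lower betas) as [N Hlow].
set (p := length alphas) in *; set (q := length betas) in *.
apply abs_summable_of_ratio with (M := (2 ^ q * Cmod z * A)%R) (N := N).
intros n Hn.
assert (E := f_equal Cmod (hyp_term_S alphas betas z n Hb)).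
rewrite !Cmod_mult, <- RtoC_INR_S, Cmod_R, Rabs_pos_eq in E by apply pos_INR.
set (t := Cmod (hyp_term alphas betas z n)) in *.
set (t' := Cmod (hyp_term alphas betas z (S n))) in *.
assert (Ht : (0 <= t)%R) by apply Cmod_ge_0.
assert (Ht' : (0 <= t')%R) by apply Cmod_ge_0.
assert (Hz := Cmod_ge_0 z).
assert (H2q : (0 < 2 ^ q)%R) by (apply pow_lt; lra).
assert (H1 : (1 <= INR (S n))%R) by (rewrite S_INR; assert (H := pos_INR n); lra).
assert (Hpq : (INR (S n) ^ p <= INR (S n) ^ q)%R) by now apply Rle_pow.
assert (Hq : (0 < INR (S n) ^ q)%R) by (apply pow_lt; lra).
apply Rmult_le_reg_l with (1 := Hq).
apply Rle_trans with (2 ^ q * (INR (S n) * Cmod (shifted_prod betas n) * t'))%R.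
- replace (2 ^ q * (INR (S n) * Cmod (shifted_prod betas n) * t'))%R
    with ((2 ^ q * Cmod (shifted_prod betas n)) * (INR (S n) * t'))%R by ring.
  apply Rmult_le_compat_r; [|now apply Hlow].
  apply Rmult_le_pos; lra.
- rewrite E.
  replace (INR (S n) ^ q * (2 ^ q * Cmod z * A * t))%R
    with (2 ^ q * (Cmod z * (A * INR (S n) ^ q) * t))%R by ring.
  apply Rmult_le_compat_l; [lra|].
  apply Rmult_le_compat_r; [exact Ht|].
  apply Rmult_le_compat_l; [exact Hz|].
  apply Rle_trans with (1 := Hup n).
  now apply Rmult_le_compat_l.
Qed.

Lemma is_series_hypergeometric (alphas betas : list C) (z : C) :
  (length alphas <= length betas)%nat -> admissible betas ->
  is_series (hyp_term alphas betas z) (hypergeometric alphas betas z).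
Proof.
intros Hlen Hb; now apply abs_summable_is_series, hyp_term_abs_summable.
Qed.

(** * The exponential series *)

Lemma exp_term_S (z : C) (n : nat) :
  (RtoC (INR n) + 1) * hyp_term [] [] z (S n) = z * hyp_term [] [] z n.
Proof.
assert (E := hyp_term_S [] [] z n (List.Forall_nil _)).
unfold shifted_prod in E; simpl in E; rewrite !Cmult_1_r in E; exact E.
Qed.

(** The product rule for [theta (u e^z)]; it trades the Euler operator on the
    product for the Euler operator on the factor [u]. *)
Lemma cauchy_product_exp_S (u : nat -> C) (z : C) (n : nat) :
  (RtoC (INR n) + 1) * cauchy_product u (hyp_term [] [] z) (S n)
  = cauchy_product (fun k => RtoC (INR k) * u k) (hyp_term [] [] z) (S n)
    + z * cauchy_product u (hyp_term [] [] z) n.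
Proof.
rewrite <- RtoC_INR_S, cauchy_product_euler; f_equal.
rewrite <- cauchy_product_scal_r.
apply cauchy_product_shift_r; [simpl; ring|].
intros k; rewrite RtoC_INR_S; apply exp_term_S.
Qed.

(** Both sides satisfy [(n+1) c_(n+1) = (w + z) c_n], which replaces the
    binomial theorem. *)
Lemma cauchy_product_exp_exp (w z : C) (n : nat) :
  cauchy_product (hyp_term [] [] w) (hyp_term [] [] z) n = hyp_term [] [] (w + z) n.
Proof.
induction n as [|n IH].
- unfold cauchy_product; rewrite sum_O, !hyp_term_0; ring.
- assert (H := INR_S_neq_0 n).
  assert (E := cauchy_product_exp_S (hyp_term [] [] w) z n).
  rewrite (cauchy_product_shift_l (fun k => RtoC (INR k) * hyp_term [] [] w k)
    (fun k => w * hyp_term [] [] w k)) in E.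
  + rewrite cauchy_product_scal_l, IH in E.
    assert (E' := exp_term_S (w + z) n).
    replace (hyp_term [] [] (w + z) (S n)) with
      (/ (RtoC (INR n) + 1) * ((RtoC (INR n) + 1) * hyp_term [] [] (w + z) (S n)))
      by (field; exact H).
    rewrite E'.
    replace ((w + z) * hyp_term [] [] (w + z) n) with
      (w * hyp_term [] [] (w + z) n + z * hyp_term [] [] (w + z) n) by ring.
    rewrite <- E; field; exact H.
  + simpl; ring.
  + intros k; rewrite RtoC_INR_S; apply exp_term_S.
Qed.

Lemma is_series_RtoC (u : nat -> R) (l : R) :
  is_series u l -> is_series (fun n => RtoC (u n)) (RtoC l).
Proof.
intros H; apply is_series_components; [exact H|]; simpl.
replace 0%R with (scal 0 l)%R by (unfold scal; simpl; unfold mult; simpl; ring).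
eapply is_series_ext; [|exact (is_series_scal 0%R _ _ H)].
intros n; unfold scal; simpl; unfold mult; simpl; ring.
Qed.

Lemma exp_term_div (z : C) (n : nat) :
  hyp_term [] [] z n = z ^ n / RtoC (INR (fact n)).
Proof.
unfold hyp_term, pochhammer_prod; simpl fold_right.
field; apply INR_fact_neq_0_C.
Qed.

Lemma is_series_exp_real (t : R) : is_series (hyp_term [] [] t) (RtoC (exp t)).
Proof.
eapply is_series_ext; [|exact (is_series_RtoC _ _ (is_exp_Reals t))].
intros n; rewrite exp_term_div, pow_n_pow.
unfold scal; simpl; unfold mult; simpl.
rewrite RtoC_mult, RtoC_inv, RtoC_pow by apply INR_fact_neq_0; reflexivity.
Qed.

Lemma Cpow_imaginary_even (t : R) (m : nat) :
  (Ci * t) ^ (2 * m) = RtoC ((-1) ^ m * (Rsqr t) ^ m).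
Proof.
rewrite Cpow_mult_r, RtoC_mult, !RtoC_pow, <- Cpow_mult_l; f_equal.
unfold Rsqr; rewrite RtoC_mult; simpl.
transitivity (Ci * Ci * (t * t)); [ring|].
f_equal; unfold Ci, Cmult, RtoC; simpl; f_equal; ring.
Qed.

(** The terms of even index form the cosine series and those of odd index
    [Ci] times the sine series. *)
Lemma is_series_exp_imaginary (t : R) :
  is_series (hyp_term [] [] (Ci * t)) ((cos t, sin t) : C).
Proof.
replace ((cos t, sin t) : C) with (RtoC (cos t) + Ci * RtoC (sin t))
  by (unfold Ci, Cmult, Cplus, RtoC; simpl; f_equal; ring).
apply is_series_even_odd.
- unfold cos; destruct (exist_cos (Rsqr t)) as [c Hc].
  apply is_series_Reals, is_series_RtoC in Hc.
  eapply is_series_ext; [|exact Hc]; intros m.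
  rewrite exp_term_div, Cpow_imaginary_even; unfold cos_n.
  unfold Cdiv; rewrite <- RtoC_inv, <- RtoC_mult by apply INR_fact_neq_0.
  f_equal; unfold Rdiv; ring.
- unfold sin; destruct (exist_sin (Rsqr t)) as [s Hs].
  apply is_series_Reals, is_series_RtoC in Hs.
  apply (is_series_scal (V := C_NormedModule) (Ci * t)) in Hs.
  replace (Ci * RtoC (t * s)) with (scal (Ci * RtoC t) (RtoC s) : C)
    by (rewrite RtoC_mult; unfold scal; simpl; unfold mult; simpl; ring).
  eapply is_series_ext; [|exact Hs]; intros m.
  rewrite exp_term_div, Cpow_add_r, Cpow_imaginary_even, Cpow_1_r; unfold sin_n.
  unfold scal; simpl; unfold mult; simpl.
  unfold Rdiv; rewrite !RtoC_mult, RtoC_inv by apply INR_fact_neq_0.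
  unfold Cdiv; ring.
Qed.

(** [e^(s + i t) = e^s e^(i t)] holds for the series as a Cauchy product, which
    reduces the claim to the real and to the purely imaginary case. *)
Lemma hypergeometric_exp (z : C) : hypergeometric [] [] z = Cexp z.
Proof.
unfold Cexp; destruct z as [s t]; simpl Re; simpl Im.
assert (E : ((s, t) : C) = RtoC s + Ci * RtoC t)
  by (unfold Ci, Cmult, Cplus, RtoC; simpl; f_equal; ring).
rewrite E.
rewrite <- (is_series_CSeries _ _ (is_series_exp_real s)).
rewrite <- (is_series_CSeries _ _ (is_series_exp_imaginary t)).
apply is_series_CSeries.
eapply is_series_ext; [|apply is_series_cauchy_product;
  apply hyp_term_abs_summable; [apply le_n | constructor
                               |apply le_n | constructor]].
intros n; apply cauchy_product_exp_exp.
Qed.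

(** * Kummer's second theorem *)

(** The terms of [e^(-x/2) 1F1(a; 2a; x)]. *)
Definition kummer_coef (a x : C) : nat -> C :=
  cauchy_product (hyp_term [a] [2 * a] x) (hyp_term [] [] (- x / 2)).

(** The terms of [e^(-x/2) theta 1F1(a; 2a; x)], where [theta = x d/dx]. *)
Definition kummer_moment (a x : C) : nat -> C :=
  cauchy_product (fun k => RtoC (INR k) * hyp_term [a] [2 * a] x k)
    (hyp_term [] [] (- x / 2)).

Lemma kummer_moment_0 (a x : C) : kummer_moment a x 0 = 0.
Proof. unfold kummer_moment, cauchy_product; rewrite sum_O; simpl; ring. Qed.

Lemma kummer_moment_S (a x : C) (n : nat) :
  kummer_moment a x (S n)
  = (RtoC (INR n) + 1) * kummer_coef a x (S n) + x / 2 * kummer_coef a x n.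
Proof.
unfold kummer_coef; rewrite cauchy_product_exp_S; unfold kummer_moment; field.
Qed.

(** The hypergeometric equation [theta (theta + 2a - 1) F = x (theta + a) F],
    multiplied by [e^(-x/2)].  The second moment [w] that it involves is
    removed by the product rule, and then so is the moment of index [n + 1]. *)
Lemma kummer_coef_moment (a x : C) (n : nat) : ~ nonpos_int (2 * a) ->
  (2 * a + RtoC (INR n)) * (RtoC (INR n) + 1) * kummer_coef a x (S n)
  = x / 2 * (kummer_moment a x n - RtoC (INR n) * kummer_coef a x n).
Proof.
intros ha.
set (f := hyp_term [a] [2 * a] x); set (e := hyp_term [] [] (- x / 2)).
set (w := cauchy_product (fun k => RtoC (INR k) * (RtoC (INR k) * f k)) e).
assert (Hw : w (S n)
  = (RtoC (INR n) + 1) * kummer_moment a x (S n) + x / 2 * kummer_moment a x n).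
{ unfold kummer_moment; rewrite cauchy_product_exp_S; fold f e w; field. }
assert (Hode : w (S n) + (2 * a - 1) * kummer_moment a x (S n)
  = x * kummer_moment a x n + x * a * kummer_coef a x n).
{ transitivity (cauchy_product (fun k => 1 * (RtoC (INR k) * (RtoC (INR k) * f k))
      + (2 * a - 1) * (RtoC (INR k) * f k)) e (S n)).
  - rewrite cauchy_product_linear_l; unfold w, kummer_moment; fold f e; ring.
  - rewrite (cauchy_product_shift_l _
      (fun k => x * (RtoC (INR k) * f k) + x * a * f k)).
    + rewrite cauchy_product_linear_l; reflexivity.
    + simpl; ring.
    + intros k.
      assert (E := hyp_term_S [a] [2 * a] x k ltac:(repeat constructor; exact ha)).
      fold f in E; unfold shifted_prod in E; simpl map in E; simpl fold_right in E.
      rewrite RtoC_INR_S.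
      transitivity ((RtoC (INR k) + 1) * ((2 * a + RtoC (INR k)) * 1) * f (S k));
        [ring|].
      rewrite E; ring. }
rewrite Hw, kummer_moment_S in Hode.
transitivity (x * kummer_moment a x n + x * a * kummer_coef a x n
  - x / 2 * kummer_moment a x n
  - (2 * a + RtoC (INR n)) * (x / 2 * kummer_coef a x n)); [|field].
rewrite <- Hode; field.
Qed.

Lemma kummer_coef_1 (a x : C) : ~ nonpos_int (2 * a) -> kummer_coef a x 1 = 0.
Proof.
intros ha.
assert (E := kummer_coef_moment a x 0 ha); rewrite kummer_moment_0 in E.
apply (Cmult_cancel_l ((2 * a + RtoC (INR 0)) * (RtoC (INR 0) + 1))).
- apply Cmult_neq_0; [now apply add_INR_neq_0 | apply INR_S_neq_0].
- rewrite E; simpl; ring.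
Qed.

(** For index [n + 1] the right-hand side of [kummer_coef_moment] is, by
    [kummer_moment_S], a multiple of [s_n] alone. *)
Lemma kummer_coef_SS (a x : C) (n : nat) : ~ nonpos_int (2 * a) ->
  (2 * a + (RtoC (INR n) + 1)) * (RtoC (INR n) + 2) * kummer_coef a x (S (S n))
  = x ^ 2 / 4 * kummer_coef a x n.
Proof.
intros ha.
assert (E := kummer_coef_moment a x (S n) ha).
rewrite kummer_moment_S, !RtoC_INR_S in E.
transitivity ((2 * a + (RtoC (INR n) + 1)) * (RtoC (INR n) + 1 + 1)
  * kummer_coef a x (S (S n))); [ring|].
rewrite E; simpl; field.
Qed.

Lemma kummer_coef_odd (a x : C) (m : nat) :
  ~ nonpos_int (2 * a) -> kummer_coef a x (2 * m + 1) = 0.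
Proof.
intros ha; induction m as [|m IH]; [now apply kummer_coef_1|].
replace (2 * S m + 1)%nat with (S (S (2 * m + 1))) by lia.
assert (E := kummer_coef_SS a x (2 * m + 1) ha); rewrite IH in E.
rewrite <- RtoC_INR_S in E.
apply (Cmult_cancel_l ((2 * a + RtoC (INR (S (2 * m + 1))))
  * (RtoC (INR (2 * m + 1)) + 2))).
- apply Cmult_neq_0; [now apply add_INR_neq_0|].
  replace (RtoC (INR (2 * m + 1)) + 2) with (RtoC (INR (S (2 * m + 1))) + 1)
    by (rewrite RtoC_INR_S; ring).
  apply INR_S_neq_0.
- rewrite E; ring.
Qed.

Lemma half_not_nonpos_int (c : C) : ~ nonpos_int c -> ~ nonpos_int (c / 2).
Proof.
intros H [n Hn]; apply H; exists (2 * n)%nat.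
replace c with (2 * (c / 2)) by field.
rewrite Hn, mult_INR, RtoC_mult; simpl INR; rewrite !RtoC_plus; ring.
Qed.

Lemma add_half_not_nonpos_int (a : C) :
  ~ nonpos_int (2 * a) -> ~ nonpos_int (a + 1 / 2).
Proof.
intros H [n Hn]; apply H; exists (S (2 * n))%nat.
rewrite RtoC_INR_S, mult_INR, RtoC_mult.
replace (2 * a) with (2 * (a + 1 / 2) - 1) by field.
rewrite Hn; simpl INR; rewrite !RtoC_plus; ring.
Qed.

Lemma kummer_coef_even (a x : C) (m : nat) : ~ nonpos_int (2 * a) ->
  kummer_coef a x (2 * m) = hyp_term [] [a + 1 / 2] (x ^ 2 / 16) m.
Proof.
intros ha; assert (hb := add_half_not_nonpos_int a ha).
induction m as [|m IH].
- unfold kummer_coef, cauchy_product; simpl mult; rewrite sum_O, !hyp_term_0; ring.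
- assert (E := kummer_coef_SS a x (2 * m) ha); rewrite IH in E.
  replace (2 * S m)%nat with (S (S (2 * m))) by lia.
  assert (E' := hyp_term_S [] [a + 1 / 2] (x ^ 2 / 16) m
                  ltac:(repeat constructor; exact hb)).
  unfold shifted_prod in E'; simpl map in E'; simpl fold_right in E'.
  replace (RtoC (INR (2 * m))) with (2 * RtoC (INR m)) in E
    by (rewrite mult_INR, RtoC_mult; simpl INR; rewrite !RtoC_plus; ring).
  apply (Cmult_cancel_l
    ((RtoC (INR m) + 1) * ((a + 1 / 2 + RtoC (INR m)) * 1))).
  + repeat apply Cmult_neq_0;
      [apply INR_S_neq_0 | now apply add_INR_neq_0 | exact C1_nz].
  + rewrite E'.
    transitivity (1 / 4 * ((2 * a + (2 * RtoC (INR m) + 1)) * (2 * RtoC (INR m) + 2)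
      * kummer_coef a x (S (S (2 * m))))); [field|].
    rewrite E; field.
Qed.

(** * The contiguous parameter pair and the product formula *)

Lemma pochhammer_add_1 (d : C) (n : nat) :
  d * pochhammer (d + 1) n = (d + RtoC (INR n)) * pochhammer d n.
Proof.
induction n as [|n IH]; [simpl; ring|].
rewrite RtoC_INR_S; simpl pochhammer.
transitivity (d * pochhammer (d + 1) n * (d + 1 + RtoC (INR n))); [ring|].
rewrite IH; ring.
Qed.

Lemma pochhammer_prod_snoc (l : list C) (c : C) (n : nat) :
  pochhammer_prod (l ++ [c]) n = pochhammer_prod l n * pochhammer c n.
Proof.
unfold pochhammer_prod; induction l as [|b l IH]; simpl in *; [ring|].
rewrite IH; ring.
Qed.

(** [(d+1)_n / (d)_n = 1 + n/d]: a parameter pair differing by one turns a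
    series [F] into [F + (theta F) / d]. *)
Lemma hyp_term_contiguous (alphas betas : list C) (d z : C) (n : nat) :
  admissible betas -> ~ nonpos_int d ->
  hyp_term (alphas ++ [d + 1]) (betas ++ [d]) z n
  = (1 + RtoC (INR n) / d) * hyp_term alphas betas z n.
Proof.
intros Hb Hd; unfold hyp_term; rewrite !pochhammer_prod_snoc.
assert (d0 := neq_0_of_not_nonpos_int d Hd).
replace (pochhammer (d + 1) n) with ((d + RtoC (INR n)) / d * pochhammer d n).
- assert (H1 := pochhammer_prod_neq_0 betas n Hb).
  assert (H2 := INR_fact_neq_0_C n).
  assert (H3 := pochhammer_prod_neq_0 [d] n ltac:(repeat constructor; exact Hd)).
  unfold pochhammer_prod in H3; simpl in H3; rewrite Cmult_1_r in H3.
  field; auto.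
- apply (Cmult_cancel_l d); [exact d0|].
  rewrite pochhammer_add_1; field; exact d0.
Qed.

Lemma cauchy_coef (a d x : C) (n : nat) : ~ nonpos_int (2 * a) -> ~ nonpos_int d ->
  cauchy_product (hyp_term [a; d + 1] [2 * a; d] x) (hyp_term [] [] (- x / 2)) n
  = kummer_coef a x n + / d * kummer_moment a x n.
Proof.
intros ha hd.
transitivity (1 * kummer_coef a x n + / d * kummer_moment a x n); [|ring].
unfold kummer_coef, kummer_moment; rewrite <- cauchy_product_linear_l.
apply sum_n_ext; intros k; f_equal.
assert (E := hyp_term_contiguous [a] [2 * a] d x k
  ltac:(repeat constructor; assumption) hd).
simpl app in E; rewrite E; unfold Cdiv; ring.
Qed.

Lemma cauchy_coef_even (a d x : C) (m : nat) :
  ~ nonpos_int (2 * a) -> ~ nonpos_int d ->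
  cauchy_product (hyp_term [a; d + 1] [2 * a; d] x) (hyp_term [] [] (- x / 2)) (2 * m)
  = hyp_term [1 + d / 2] [a + 1 / 2; d / 2] (x ^ 2 / 16) m.
Proof.
intros ha hd; rewrite cauchy_coef by assumption.
assert (d0 := neq_0_of_not_nonpos_int d hd).
assert (E := hyp_term_contiguous [] [a + 1 / 2] (d / 2) (x ^ 2 / 16) m
  ltac:(repeat constructor; now apply add_half_not_nonpos_int)
  (half_not_nonpos_int d hd)).
rewrite (Cplus_comm (d / 2)) in E; simpl app in E; rewrite E.
rewrite <- kummer_coef_even by exact ha.
destruct m as [|m].
- change (2 * 0)%nat with 0%nat; rewrite kummer_moment_0; simpl; field; exact d0.
- (* [kummer_moment_S] leaves a multiple of the coefficient of index
     [2 * m + 1], which is zero *)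
  replace (2 * S m)%nat with (S (2 * m + 1)) by lia.
  rewrite kummer_moment_S, kummer_coef_odd by exact ha.
  rewrite <- RtoC_INR_S; replace (S (2 * m + 1)) with (2 * S m)%nat by lia.
  rewrite mult_INR, RtoC_mult.
  change (INR 2) with (1 + 1)%R; rewrite RtoC_plus; field; exact d0.
Qed.

Lemma cauchy_coef_odd (a d x : C) (m : nat) :
  ~ nonpos_int (2 * a) -> ~ nonpos_int d ->
  cauchy_product (hyp_term [a; d + 1] [2 * a; d] x) (hyp_term [] [] (- x / 2))
    (2 * m + 1)
  = x / (2 * d) * hyp_term [] [a + 1 / 2] (x ^ 2 / 16) m.
Proof.
intros ha hd; rewrite cauchy_coef by assumption.
assert (d0 := neq_0_of_not_nonpos_int d hd).
rewrite <- kummer_coef_even by exact ha.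
replace (2 * m + 1)%nat with (S (2 * m)) by lia.
rewrite kummer_moment_S.
replace (S (2 * m)) with (2 * m + 1)%nat by lia.
rewrite kummer_coef_odd by exact ha; field; exact d0.
Qed.

Theorem theorem2p1 (a d : C)
  (ha : ~ nonpos_int (2 * a)) (hd : ~ nonpos_int d) (x : C) :
  Cexp (- x / 2) * hypergeometric [a; d + 1] [2 * a; d] x
  = hypergeometric [1 + d / 2] [a + 1 / 2; d / 2] (x ^ 2 / 16)
    + x / (2 * d) * hypergeometric [] [a + 1 / 2] (x ^ 2 / 16).
Proof.
assert (hb := add_half_not_nonpos_int a ha).
assert (hd2 := half_not_nonpos_int d hd).
rewrite <- hypergeometric_exp, Cmult_comm.
transitivity (CSeries (cauchy_product
  (hyp_term [a; d + 1] [2 * a; d] x) (hyp_term [] [] (- x / 2)))).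
- symmetry; apply is_series_CSeries, is_series_cauchy_product;
    apply hyp_term_abs_summable; simpl; try lia; repeat constructor; assumption.
- apply is_series_CSeries, is_series_even_odd.
  + eapply is_series_ext;
      [intros m; symmetry; now apply cauchy_coef_even|].
    apply is_series_hypergeometric;
      [simpl; lia | repeat constructor; assumption].
  + eapply is_series_ext;
      [intros m; symmetry; now apply cauchy_coef_odd|].
    apply (is_series_scal (V := C_NormedModule)), is_series_hypergeometric;
      [simpl; lia | repeat constructor; assumption].
Qed.
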